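(* Let $k\ge 3$ and let $P_k$ be the path with $k$ edges. Then $\sup_n \mathrm{schex}_3(n,\mathcal{B}(P_k))=k$ and $\sup_n \mathrm{wchex}_3(n,\mathcal{B}(P_k))=\lceil k/2\rceil$.
   Context: For a graph $F$, a hypergraph $\mathcal{H}$ is a Berge-$F$ if there is a bijection $f:E(F)\to E(\mathcal{H})$ with $e\subseteq f(e)$ for every $e\in E(F)$; $\mathcal{B}(F)$ is the family of Berge-$F$ hypergraphs, and $\mathcal{B}(F)$-free means containing no subhypergraph in $\mathcal{B}(F)$. $\mathrm{schex}_3(n,\mathcal{B}(F))$ (resp. $\mathrm{wchex}_3(n,\mathcal{B}(F))$) is the supremum of the strong (resp. weak) chromatic number over $\mathcal{B}(F)$-free $3$-uniform hypergraphs on $n$ vertices. The strong chromatic number is the minimum number of colors in a vertex coloring with every hyperedge rainbow; the weak chromatic number is the minimum number of colors in a vertex coloring with no monochromatic hyperedge. *)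

(* Defs.v *)
From mathcomp Require Import all_boot all_order.

Set Implicit Arguments.
Unset Strict Implicit.
Unset Printing Implicit Defensive.

(* A hypergraph with vertex set T is given by its set of hyperedges; a (simple)
   graph is the case where all the edges have cardinality 2. *)
Notation hypergraph T := {set {set T}}.

Definition uniform (r : nat) (T : finType) (H : hypergraph T) : bool :=
  [forall e in H, #|e| == r].

(* The path with k edges, on the k.+1 vertices 0, ..., k: its i-th edge joins
   i and i.+1, for i < k. *)
Definition path_graph (k : nat) : hypergraph 'I_k.+1 :=
  [set [set widen_ord (leqnSn k) i; lift ord0 i] | i : 'I_k].

(* Predicates on the hypergraphs with an arbitrary finite vertex set. *)
Definition hypergraph_family := forall T : finType, pred (hypergraph T).

(* The vertices of F are identified with vertices of H by the injection phi.
   The function g is only relevant on the edges of F, which it maps bijectively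
   onto the hyperedges of H. *)
Definition berge (V : finType) (F : hypergraph V) : hypergraph_family :=
  fun T H =>
  [exists phi : {ffun V -> T}, exists g : {ffun {set V} -> {set T}},
    [&& injectiveb phi, dinjectiveb g (mem F), g @: F == H
      & [forall e in F, phi @: e \subset g e]]].

(* It is enough to consider the subhypergraphs having all of T as vertex set,
   since isolated vertices play no role in the families berge F. *)
Definition family_free (B : hypergraph_family) (T : finType)
    (H : hypergraph T) : bool :=
  [forall (H' : hypergraph T | H' \subset H), ~~ B T H'].

Definition strong_coloring (T : finType) (H : hypergraph T) (c : nat)
    (f : {ffun T -> 'I_c}) : bool :=
  [forall e in H, dinjectiveb f (mem e)].

Definition monochromatic (T : finType) (c : nat) (f : {ffun T -> 'I_c})
    (e : {set T}) : bool :=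
  [forall x in e, forall y in e, f x == f y].

Definition weak_coloring (T : finType) (H : hypergraph T) (c : nat)
    (f : {ffun T -> 'I_c}) : bool :=
  [forall e in H, ~~ monochromatic f e].

Definition strong_colorable (T : finType) (H : hypergraph T) (c : nat) : bool :=
  [exists f : {ffun T -> 'I_c}, strong_coloring H f].

Definition weak_colorable (T : finType) (H : hypergraph T) (c : nat) : bool :=
  [exists f : {ffun T -> 'I_c}, weak_coloring H f].

(* The minimum is sought among 0, ..., #|T|, as #|T| colors always suffice; for
   weak colorings this requires hyperedges of cardinality at least 2 (see
   strong_chromaticP and weak_chromaticP). *)
Definition strong_chromatic (T : finType) (H : hypergraph T) : nat :=
  [arg min_(c < (ord_max : 'I_#|T|.+1) | strong_colorable H c) c].

Definition weak_chromatic (T : finType) (H : hypergraph T) : nat :=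
  [arg min_(c < (ord_max : 'I_#|T|.+1) | weak_colorable H c) c].

Lemma strong_chromaticP (T : finType) (H : hypergraph T) :
  strong_colorable H (strong_chromatic H) /\
  forall c, strong_colorable H c -> strong_chromatic H <= c.
Proof.
rewrite /strong_chromatic; case: arg_minnP => [|m mP mmin].
  apply/existsP; exists [ffun x => enum_rank x]; apply/forall_inP => e _.
  by apply/dinjectiveP => x y _ _; rewrite !ffunE => /enum_rank_inj.
split=> // c cP; have [ltc|gtc] := ltnP c #|T|.+1.
  exact: (mmin (Ordinal ltc)).
exact: leq_trans (ltnW (ltn_ord m)) gtc.
Qed.

Lemma weak_chromaticP (T : finType) (H : hypergraph T) :
  (forall e, e \in H -> 1 < #|e|) ->
  weak_colorable H (weak_chromatic H) /\
  forall c, weak_colorable H c -> weak_chromatic H <= c.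
Proof.
move=> H2; rewrite /weak_chromatic; case: arg_minnP => [|m mP mmin].
  apply/existsP; exists [ffun x => enum_rank x]; apply/forall_inP => e eH.
  have /card_gt1P[x [y [xe ye /eqP neq]]] := H2 e eH.
  apply/negP => /forall_inP/(_ x xe)/forall_inP/(_ y ye).
  by rewrite !ffunE => /eqP/enum_rank_inj.
split=> // c cP; have [ltc|gtc] := ltnP c #|T|.+1.
  exact: (mmin (Ordinal ltc)).
exact: leq_trans (ltnW (ltn_ord m)) gtc.
Qed.

(* The supremum over the finitely many hypergraphs with vertex set 'I_n. *)
Definition schex (r n : nat) (B : hypergraph_family) : nat :=
  \max_(H : hypergraph 'I_n | uniform r H && family_free B H)
    strong_chromatic H.

Definition wchex (r n : nat) (B : hypergraph_family) : nat :=
  \max_(H : hypergraph 'I_n | uniform r H && family_free B H)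
    weak_chromatic H.

(* Main.v *)
Require Import Defs.
From mathcomp Require Import classical_sets.
From mathcomp Require Import all_boot all_order zify.

(* Join two vertices when some hyperedge contains both. If every vertex of a
   nonempty set S had at least k neighbours in S, any Berge path in S with
   l < k edges could be extended, giving a Berge path with k edges. Indeed, if a
   path v_0, ..., v_l cannot be extended at v_0, then a neighbour of v_0 off the
   path can only be reached through the first hyperedge, which has room for one
   such vertex x; the degree bound then forces l = k-1 and v_0 adjacent to all
   v_i. The same holds at v_l, so the first and last hyperedges both leave the
   path, and as hyperedges have three vertices, the hyperedge f through v_0 and
   v_l is not on the path. Then x, v_1, ..., v_l, v_0 is a longer path, ending
   with f. Hence a hypergraph without Berge path is (k-1)-degenerate and greedily
   strongly k-colorable; merging the colours two by two gives a weak coloring.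
   Both bounds are attained by the complete 3-uniform hypergraph on k
   vertices. *)

Set Implicit Arguments.
Unset Strict Implicit.
Unset Printing Implicit Defensive.

Lemma card_ge4 (T : finType) (A : {set T}) (a b c d : T) :
  uniq [:: a; b; c; d] -> {subset [:: a; b; c; d] <= A} -> 3 < #|A|.
Proof.
move=> Us sA; rewrite -[4]/(size [:: a; b; c; d]) -(card_uniqP Us).
by apply/subset_leq_card/subsetP.
Qed.

(** * Extending Berge paths under a minimum degree condition *)

Section BergePaths.
Variables (T : finType) (H : hypergraph T) (S : {set T}).

Definition adjacent (x y : T) : bool :=
  (x != y) && [exists e in H, (x \in e) && (y \in e)].

Definition neighbours (x : T) : {set T} := [set y in S | adjacent x y].

(* The path has vertices v 0, ..., v l and edges e 0, ..., e l.-1; only the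
   vertices of the path, not its hyperedges, are confined to S. *)
Definition bpath (l : nat) (v : nat -> T) (e : nat -> {set T}) : Prop :=
  [/\ forall i, i <= l -> v i \in S,
      forall i j, i <= l -> j <= l -> v i = v j -> i = j,
      forall i, i < l -> e i \in H,
      forall i j, i < l -> j < l -> e i = e j -> i = j
    & forall i, i < l -> (v i \in e i) && (v i.+1 \in e i)].

Lemma bpath_rev (l : nat) v e :
  bpath l v e -> bpath l (fun i => v (l - i)) (fun i => e (l - i.+1)).
Proof.
case=> vS vinj eH einj inc; split=> [i li|i j li lj /vinj|i li|i j li lj /einj|i li].
- by apply: vS; lia.
- by lia.
- by apply: eH; lia.
- by lia.
have /inc/andP[] : l - i.+1 < l by lia.
by rewrite (_ : (l - i.+1).+1 = l - i) => [->->|]; lia.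
Qed.

Lemma bpath_cons (l : nat) v e w f :
    bpath l v e -> w \in S -> f \in H -> w \in f -> v 0 \in f ->
    (forall i, i <= l -> w <> v i) -> (forall i, i < l -> f <> e i) ->
  exists v' e', bpath l.+1 v' e'.
Proof.
case=> vS vinj eH einj inc wS fH wf v0f wP fQ.
exists (fun i => if i is j.+1 then v j else w).
exists (fun i => if i is j.+1 then e j else f).
split=> [[|i] li|[|i] [|j] li lj //=|[|i] li|[|i] [|j] li lj //=|[|i] li] //.
- by apply: vS; lia.
- by move/wP; lia.
- by move/esym/wP; lia.
- by move/vinj=> ->; lia.
- by apply: eH; lia.
- by move/fQ; lia.
- by move/esym/fQ; lia.
- by move/einj=> ->; lia.
- by rewrite wf v0f.
- by apply: inc.
Qed.

(** The distinct vertices [v i] and [v i.+1] leave room for only one more vertex in [e i], so [z]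
    and [w] cannot both avoid them. *)
Lemma bpath_edge_vertex (l : nat) v e i z w :
    uniform 3 H -> bpath l v e -> i < l -> z \in e i -> w \in e i -> z != w ->
  exists2 j, i <= j <= i.+1 & z = v j \/ w = v j.
Proof.
move=> H3 [_ vinj eH _ inc] il ze we nzw.
have /andP[ve ve1] := inc _ il; have /eqP e3 := forall_inP H3 _ (eH _ il).
have [zi|zi] := eqVneq z (v i); first by exists i; [rewrite leqnn leqnSn | left].
have [zi1|zi1] := eqVneq z (v i.+1); first by exists i.+1; [rewrite leqnn leqnSn | left].
have [wi|wi] := eqVneq w (v i); first by exists i; [rewrite leqnn leqnSn | right].
have [wi1|wi1] := eqVneq w (v i.+1); first by exists i.+1; [rewrite leqnn leqnSn | right].
have nv : v i != v i.+1 by apply/eqP => /(vinj _ _ (ltnW il) il)/n_Sn.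
suff : 3 < #|e i| by rewrite e3.
apply: (@card_ge4 _ _ z w (v i) (v i.+1)).
  by rewrite /= !inE !negb_or nzw zi zi1 wi wi1 nv.
by move=> t; rewrite !inE => /or4P[]/eqP->.
Qed.

Lemma bpath_edge_off_vertex (l : nat) v e i z m :
    uniform 3 H -> bpath l v e -> i < l -> z \in e i -> v m \in e i -> m <= l ->
    (forall j, j <= l -> z <> v j) ->
  i <= m <= i.+1.
Proof.
move=> H3 bp il ze vme ml zP.
have [j ij] := bpath_edge_vertex H3 bp il ze vme (introN eqP (zP m ml)).
have jl : j <= l by case/andP: ij => _ /leq_trans; apply.
by case=> [/(zP j jl)//|]; case: bp => _ vinj _ _ _ /(vinj _ _ ml jl)->.
Qed.

Lemma bpath_endpoint (k l : nat) v e :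
    uniform 3 H -> l < k -> bpath l v e -> k <= #|neighbours (v 0)| ->
  (exists v' e', bpath l.+1 v' e') \/
  [/\ l.+1 = k, forall i, 0 < i <= l -> adjacent (v 0) (v i)
    & exists x, [/\ x \in S, x \in e 0 & forall i, i <= l -> x <> v i]].
Proof.
move=> H3 lk bp deg; have [vS vinj eH einj inc] := bp.
pose P := [set v (val i) | i : 'I_l.+1].
have inP x : reflect (exists2 i, i <= l & x = v i) (x \in P).
  apply: (iffP imsetP) => [[i _ ->]|[i li ->]]; first by exists (val i) => //; exact: leq_ord.
  by exists (Ordinal (li : i < l.+1)).
have cP : #|P| = l.+1.
  by rewrite card_imset ?card_ord// => i j vij; apply/val_inj/(vinj _ _ _ _ vij); apply: leq_ord.
have [/exists_inP[w wS /exists_inP[f fH /and4P[wf v0f wP /forallP fQ]]]|none] :=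
  boolP [exists w in S, exists f in H,
    [&& w \in f, v 0 \in f, w \notin P & [forall i : 'I_l, f != e i]]].
  left; apply: (bpath_cons bp wS fH wf v0f) => i li.
    by move=> wE; case/negP: wP; apply/inP; exists i.
  by apply/eqP; apply: (fQ (Ordinal li)).
right.
have v0P : v 0 \in P by apply/inP; exists 0.
(* Candidate neighbours of [v 0] off the path. For [l = 0] there is no first hyperedge and [e 0] is
   arbitrary, hence the empty set. *)
pose X := if 0 < l then S :&: (e 0 :\: P) else set0.
have sN : neighbours (v 0) \subset (P :\ v 0) :|: X.
  apply/subsetP => w; rewrite !inE => /and3P[wS nw /exists_inP[f fH /andP[v0f wf]]].
  rewrite eq_sym nw /=; case: (boolP (w \in P)) => //= wP.
  (* As the path cannot be extended by [w] through [f], this [f] is some [e i]. It contains [v 0]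
     and the off-path vertex [w], which forces [i = 0]. *)
  have /forallPn[/= i /negPn/eqP fE] : ~~ [forall i : 'I_l, f != e i].
    apply: contra none => fQ; apply/exists_inP; exists w => //.
    by apply/exists_inP; exists f => //; apply/and4P.
  rewrite /X (leq_ltn_trans _ (ltn_ord i))// !inE wS wP/=.
  have [i0|i0] := posnP i; first by rewrite -i0 -fE.
  rewrite fE in v0f wf.
  have /andP[+ _] := bpath_edge_off_vertex H3 bp (ltn_ord i) wf v0f (leq0n l)
    (fun j jl wE => negP wP (introT (inP w) (ex_intro2 _ _ j jl wE))).
  by rewrite leqNgt i0.
have cX : #|X| <= (0 < l).
  rewrite /X; case: ltnP => [l0|_]; last by rewrite cards0.
  have /andP[v0e v1e] := inc _ l0.
  have/forall_inP/(_ _ (eH _ l0))/eqP e3 := H3.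
  apply: leq_trans (subset_leq_card (subsetIr _ _)) _.
  have : #|[set v 0; v 1]| <= #|e 0 :&: P|.
    apply/subset_leq_card/subsetP => z; rewrite !inE => /orP[]/eqP->.
      by rewrite v0e v0P.
    by rewrite v1e; apply/inP; exists 1.
  rewrite cards2 (_ : v 0 != v 1); last by apply/eqP => /vinj; lia.
  have := cardsID P (e 0); rewrite e3; lia.
have cP0 : #|P :\ v 0| = l by have := cardsD1 (v 0) P; rewrite v0P cP; lia.
have cU := cardsU (P :\ v 0) X.
have cN := subset_leq_card sN.
have b1 : (0 < l) <= 1 by case: (0 < l).
(* The bounds [k <= #|neighbours (v 0)| <= l + #|X| <= l.+1 <= k] are all equalities; the three
   conclusions follow. *)
have eqN : neighbours (v 0) = (P :\ v 0) :|: X.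
  by apply/eqP; rewrite eqEcard sN; lia.
split; first by lia.
  move=> i /andP[i0 il]; suff: v i \in neighbours (v 0) by rewrite inE => /andP[].
  rewrite eqN !inE; apply/orP; left; apply/andP; split.
    by apply/eqP => /vinj; lia.
  by apply/inP; exists i.
have /card_gt0P[x] : 0 < #|X| by lia.
rewrite /X; case: ifP => _; rewrite !inE // => /and3P[xS xP xe].
by exists x; split=> // i il xE; case/negP: xP; apply/inP; exists i.
Qed.

Lemma bpath_extend (k l : nat) v e :
    3 <= k -> uniform 3 H -> {in S, forall x, k <= #|neighbours x|} ->
    l < k -> bpath l v e ->
  exists v' e', bpath l.+1 v' e'.
Proof.
move=> k3 H3 deg lk bp; have [vS vinj eH einj inc] := bp.
have [//|[lE adj [x [xS xe xP]]]] := bpath_endpoint H3 lk bp (deg _ (vS 0 isT)).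
(* On the reversed path the first hyperedge is [e (l - 1)], so [y] is its vertex off the path. *)
have [//|[_ _ [y []]]] := bpath_endpoint H3 lk (bpath_rev bp) (deg _ (vS _ (leq_subr _ _))).
move=> yS ye yP.
have {}yP i : i <= l -> y <> v i.
  by move=> il; have := yP (l - i); rewrite subKn//; apply; lia.
have /adj/andP[_ /exists_inP[f fH /andP[v0f vlf]]] : 0 < l <= l by lia.
have l1 : 1 < l by rewrite -ltnS lE.
(* With [1 < l], [e 0] is filled by [x], [v 0], [v 1] and misses [v l]; symmetrically [e (l - 1)]
   misses [v 0]. Any other [e i] would have to contain [v 0], [v l] and two interior path
   vertices. *)
have fQ i : i < l -> f <> e i.
  move=> il fE; rewrite fE in v0f vlf.
  have [i0|i0] := posnP i.
    rewrite -i0 in xe; have := bpath_edge_off_vertex H3 bp il xe vlf (leqnn l) xP.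
    by case/andP=> _; rewrite i0 leqNgt l1.
  have [il1|il1] := eqVneq i (l - 1).
    rewrite -il1 in ye; have := bpath_edge_off_vertex H3 bp il ye v0f (leq0n l) yP.
    by rewrite leqNgt i0.
  have v0l : v 0 != v l by apply/eqP => /(vinj _ _ (leq0n l) (leqnn l)) l0; rewrite -l0 in l1.
  have [j /andP[ij ji1]] := bpath_edge_vertex H3 bp il v0f vlf v0l.
  have jl := leq_trans ji1 il.
  case=> /vinj => [/(_ (leq0n l) jl)|/(_ (leqnn l) jl)] jE; first by rewrite -jE leqNgt i0 in ij.
  by clear -jE ji1 il il1; lia.
(* Since [x] takes the place of [v 0] in [e 0], the vertex [v 0] is free to be appended at the other
   end through [f]. *)
exists (fun i => if i == 0 then x else if i == l.+1 then v 0 else v i).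
exists (fun i => if i == l then f else e i).
split.
- move=> i il; case: eqP => // _; case: eqP => [_|i1]; first exact: vS.
  by apply: vS; lia.
- move=> i j il jl; case: (eqVneq i 0) => i0; case: (eqVneq j 0) => j0.
  + by lia.
  + by case: eqP => jl1 /xP; lia.
  + by case: eqP => il1 /esym/xP; lia.
  + by case: eqP => il1; case: eqP => jl1 /vinj; lia.
- by move=> i il; case: eqP => // il1; apply: eH; lia.
- move=> i j il jl; case: eqP => il1; case: eqP => jl1.
  + by lia.
  + by move/fQ; lia.
  + by move/esym/fQ; lia.
  + by move/einj; lia.
- move=> i il.
  rewrite eqSS /= (_ : (i == l.+1) = false); last by apply/eqP; lia.
  case: (eqVneq i l) => [->|il1].
    by rewrite (_ : (l == 0) = false) ?vlf ?v0f //; apply/eqP; lia.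
  have /inc/andP[ve ->] : i < l by lia.
  by case: eqP => [->|_]; rewrite ?xe ?ve.
Qed.

End BergePaths.

(** * From Berge paths to the forbidden family *)

Lemma path_graph_edge_inj (k : nat) :
  injective (fun i : 'I_k => [set widen_ord (leqnSn k) i; lift ord0 i]).
Proof.
move=> i j /= /setP eqE; apply/val_inj => /=.
have := eqE (widen_ord (leqnSn k) i); have := eqE (widen_ord (leqnSn k) j).
rewrite !inE -!val_eqE /= /bump /=; lia.
Qed.

Lemma bpath_berge (T : finType) (H : hypergraph T) (S : {set T}) (k : nat) v e :
  bpath H S k v e -> ~~ family_free (berge (path_graph k)) H.
Proof.
case=> vS vinj eH einj inc.
pose edge (i : 'I_k) := [set widen_ord (leqnSn k) i; lift ord0 i].
(* The index of an edge is recovered by [pick], unambiguously by [path_graph_edge_inj]; [set0] is a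
   default off the path graph. *)
pose g : {ffun {set 'I_k.+1} -> {set T}} := [ffun E =>
  if [pick i | E == edge i] is Some i then e (val i) else set0].
have gE i : g (edge i) = e i.
  rewrite ffunE; case: pickP => [j /eqP/path_graph_edge_inj->//|/(_ i)].
  by rewrite eqxx.
apply/forall_inPn; exists (g @: path_graph k).
  apply/subsetP => _ /imsetP[_ /imsetP[i _ ->] ->].
  by rewrite gE eH.
apply/negPn/existsP; exists [ffun i : 'I_k.+1 => v i].
apply/existsP; exists g; apply/and4P; split=> //.
- apply/injectiveP => i j; rewrite !ffunE => vij.
  by apply/val_inj/(vinj _ _ _ _ vij); apply: leq_ord.
- apply/dinjectiveP => _ _ /imsetP[i _ ->] /imsetP[j _ ->].
  by rewrite !gE => eij; congr (edge _); apply/val_inj/(einj _ _ _ _ eij); apply: ltn_ord.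
- apply/forall_inP => _ /imsetP[i _ ->]; rewrite gE.
  have /andP[ve ve1] := inc _ (ltn_ord i).
  apply/subsetP => _ /imsetP[j + ->]; rewrite !inE ffunE => /orP[]/eqP-> //=.
Qed.

Lemma low_degree_vertex (T : finType) (H : hypergraph T) (S : {set T}) (k : nat) :
    3 <= k -> uniform 3 H -> family_free (berge (path_graph k)) H ->
    0 < #|S| ->
  exists2 x, x \in S & #|neighbours H S x| < k.
Proof.
move=> k3 H3 free /card_gt0P[x0 x0S]; apply/exists_inP.
apply: contraT => /exists_inPn hdeg.
have deg : {in S, forall x, k <= #|neighbours H S x|}.
  by move=> x /hdeg; rewrite -leqNgt.
have bpathP l : l <= k -> exists v e, bpath H S l v e.
  elim: l => [_|l IHl lk]; last first.
    by have [v [e bp]] := IHl (ltnW lk); apply: bpath_extend k3 H3 deg lk bp.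
  (* The growth starts from a single vertex, with no hyperedge, so [set0] is a dummy. *)
  by exists (fun=> x0), (fun=> set0); split=> // i j; rewrite !leqn0 => /eqP-> /eqP->.
have [v [e /bpath_berge]] := bpathP k (leqnn k).
by rewrite free.
Qed.

(** * Greedy coloring and the upper bounds *)

Lemma degenerate_coloring (T : finType) (H : hypergraph T) (k : nat) :
    (forall S : {set T}, 0 < #|S| -> exists2 x, x \in S & #|neighbours H S x| < k) ->
    0 < k ->
  forall S : {set T}, exists f : {ffun T -> 'I_k},
    {in S &, forall x y, adjacent H x y -> f x != f y}.
Proof.
move=> low k0 S; have [n] := ubnP #|S|; elim: n S => // n IHn S Sn.
have [S0|/low[x xS degx]] := posnP #|S|.
  exists [ffun=> Ordinal k0] => x y.
  by rewrite (cards0_eq S0) inE.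
have [|f fP] := IHn (S :\ x).
  by have := cardsD1 x S; rewrite xS; lia.
(* After coloring [S :\ x], the fewer than [k] neighbours of [x] in [S] leave a colour free for
   [x]. *)
have [c cP] : exists c, c \notin f @: neighbours H S x.
  apply/existsP; rewrite -negb_forall; apply/negP => /forallP all_c.
  have : #|'I_k| <= #|f @: neighbours H S x|.
    by apply/subset_leq_card/subsetP => c _; apply: all_c.
  have := leq_imset_card f (neighbours H S x); rewrite card_ord; lia.
have cN y : y \in S -> adjacent H x y -> c != f y.
  move=> yS xy; apply: contraNneq cP => ->; apply: imset_f.
  by rewrite inE yS.
have adjC y z : adjacent H y z = adjacent H z y.
  rewrite /adjacent eq_sym; congr (_ && _).
  by apply: eq_existsb => e; rewrite [(y \in e) && _]andbC.
exists [ffun y => if y == x then c else f y] => y z yS zS yz; rewrite !ffunE.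
have [yx|nyx] := eqVneq y x; have [zx|nzx] := eqVneq z x.
- by move: yz; rewrite yx zx /adjacent eqxx.
- by apply: cN; rewrite -?yx.
- by rewrite eq_sym; apply: cN; rewrite -?zx // adjC.
- by apply: fP; rewrite // !inE ?nyx ?nzx.
Qed.

Lemma berge_path_free_strong_colorable (T : finType) (H : hypergraph T) (k : nat) :
    3 <= k -> uniform 3 H -> family_free (berge (path_graph k)) H ->
  strong_colorable H k.
Proof.
move=> k3 H3 free.
have low S := low_degree_vertex (S := S) k3 H3 free.
have [f fP] := degenerate_coloring low (ltnW (ltnW k3)) [set: T].
apply/existsP; exists f; apply/forall_inP => e eH; apply/dinjectiveP => x y xe ye fxy.
apply/eqP; apply: contraT => nxy.
have : f x != f y.
  by apply: fP; rewrite ?inE // /adjacent nxy; apply/exists_inP; exists e => //; apply/andP.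
by rewrite fxy eqxx.
Qed.

(* Merging the colours 2i and 2i+1 is harmless for weak colorings, since a
   hyperedge carries three distinct colours. *)
Lemma strong_to_weak_colorable (T : finType) (H : hypergraph T) (k : nat) :
  uniform 3 H -> strong_colorable H k -> weak_colorable H (uphalf k).
Proof.
move=> H3 /existsP[f /forall_inP fP].
have half_lt (i : 'I_k) : i./2 < uphalf k by have := ltn_ord i; lia.
apply/existsP; exists [ffun x => Ordinal (half_lt (f x))].
apply/forall_inP => e eH; apply/negP => /forall_inP mono.
have /eqP e3 := forall_inP H3 _ eH; have /dinjectiveP finj := fP _ eH.
have /card_gt2P[x [y [z [[xe ye ze] [nxy nyz nzx]]]]] : 2 < #|e| by rewrite e3.
have half_eq u w : u \in e -> w \in e -> (f u)./2 = (f w)./2.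
  by move=> ue we; have /forall_inP/(_ w we)/eqP := mono u ue; rewrite !ffunE => /(congr1 val).
have neq u w : u \in e -> w \in e -> u != w -> f u <> f w :> nat.
  by move=> ue we /eqP nuw /val_inj/(finj _ _ ue we).
have := half_eq x y xe ye; have := half_eq x z xe ze.
have := neq x y xe ye nxy; have := neq y z ye ze nyz; have := neq z x ze xe nzx.
lia.
Qed.

(** * The extremal example and the lower bounds *)

Definition complete3 (k : nat) : hypergraph 'I_k := [set e : {set 'I_k} | #|e| == 3].

Lemma uniform_complete3 (k : nat) : uniform 3 (complete3 k).
Proof. by apply/forall_inP => e; rewrite inE. Qed.

(** The path has [k.+1] vertices, too many to inject into [k]. *)
Lemma complete3_free (k : nat) : family_free (berge (path_graph k)) (complete3 k).
Proof.
apply/forall_inP => H' _; apply/negP => /existsP[phi /existsP[g /and4P[/injectiveP inj _ _ _]]].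
by have := leq_card phi inj; rewrite !card_ord ltnn.
Qed.

(** Any two vertices lie in a common triple, a third vertex existing as [3 <= k], so a strong
    coloring is injective. *)
Lemma complete3_strong (k c : nat) :
  3 <= k -> strong_colorable (complete3 k) c -> k <= c.
Proof.
move=> k3 /existsP[f /forall_inP fP].
suff /leq_card : injective f by rewrite !card_ord.
move=> x y fxy; apply/eqP; apply: contraT => nxy.
have /card_gt0P[z] : 0 < #|~: [set x; y]|.
  by have := cardsC [set x; y]; rewrite cards2 nxy card_ord; lia.
rewrite !inE => nz.
have /fP/dinjectiveP/(_ x y) : z |: [set x; y] \in complete3 k.
  by rewrite inE cardsU1 !inE nz cards2 nxy.
by rewrite !inE !eqxx !orbT => /(_ isT isT fxy) xy; rewrite xy eqxx in nxy.
Qed.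

(** Three vertices of one colour would form a monochromatic hyperedge, so each colour class has at
    most two. *)
Lemma complete3_weak (k c : nat) : weak_colorable (complete3 k) c -> uphalf k <= c.
Proof.
move=> /existsP[f /forall_inP fP].
have fib (i : 'I_c) : #|[set x | f x == i]| <= 2.
  rewrite leqNgt; apply/negP => /card_gt2P[x [y [z [[xe ye ze] [nxy nyz nzx]]]]].
  rewrite !inE in xe ye ze.
  have /fP/negP : x |: [set y; z] \in complete3 k.
    by rewrite inE cardsU1 !inE negb_or nxy [x == z]eq_sym nzx cards2 nyz.
  case; apply/forall_inP => u; rewrite !inE => ue; apply/forall_inP => w; rewrite !inE => we.
  have fE t : [|| t == x, t == y | t == z] -> f t = i by case/or3P=> /eqP->; apply/eqP.
  by rewrite !fE.
suff : k <= c * 2 by lia.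
rewrite -[X in X <= _]card_ord -sum1_card (partition_big f predT) //=.
rewrite -[X in X * 2]card_ord -sum_nat_const; apply: leq_sum => i _.
by rewrite sum1dep_card.
Qed.

Theorem theorem1p6 (k : nat) (hk : 3 <= k) :
  supremums (range (fun n : nat => schex 3 n (berge (path_graph k))))%classic k /\
  supremums (range (fun n : nat => wchex 3 n (berge (path_graph k))))%classic
    (uphalf k).
Proof.
have edge_gt1 (T : finType) (H : hypergraph T) : uniform 3 H ->
    forall e, e \in H -> 1 < #|e|.
  by move=> /forall_inP H3 e /H3/eqP->.
have complete3P : uniform 3 (complete3 k) && family_free (berge (path_graph k)) (complete3 k).
  by rewrite uniform_complete3 complete3_free.
split; split.
- move=> _ [n _ <-]; rewrite leEnat; apply/bigmax_leqP => H /andP[H3 free].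
  by apply: (strong_chromaticP H).2; apply: berge_path_free_strong_colorable.
(* An upper bound [m] is tested at [n = k], where [complete3 k] attains the value. *)
- move=> m /(_ _ (ex_intro2 _ _ k I erefl)); rewrite !leEnat; apply: leq_trans.
  apply: (bigmax_sup (complete3 k)) => //.
  by apply: complete3_strong hk _; apply: (strong_chromaticP _).1.
- move=> _ [n _ <-]; rewrite leEnat; apply/bigmax_leqP => H /andP[H3 free].
  apply: (weak_chromaticP (edge_gt1 _ _ H3)).2.
  by apply: strong_to_weak_colorable => //; apply: berge_path_free_strong_colorable.
- move=> m /(_ _ (ex_intro2 _ _ k I erefl)); rewrite !leEnat; apply: leq_trans.
  apply: (bigmax_sup (complete3 k)) => //.
  apply: complete3_weak.
  exact: (weak_chromaticP (edge_gt1 _ _ (uniform_complete3 k))).1.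
Qed.
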